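(* Let $\mathcal{D}$ be a $2$-$(v,k,1)$ design (Steiner system) with $b>v$ blocks and replication number $r=\frac{v-1}{k-1}$. Let $\Gamma$ be the graph whose vertices are the points and the blocks of $\mathcal{D}$, where no two points are adjacent, a point and a block are adjacent if and only if they are incident, and two distinct blocks are adjacent if and only if they intersect in one point. Then $\Gamma$ has exactly three distinct $\mathcal{L}$-eigenvalues, the non-trivial (non-zero) ones being $1+\frac{1}{r}$ and $1-\frac{1}{k}+\frac{1}{rk}$.
   Context: All graphs are finite, simple and undirected. $d_u$ denotes the valency (degree) of vertex $u$. The normalized Laplacian of a graph is the matrix $\mathcal{L}=[\ell_{uv}]$ indexed by the vertices with $\ell_{uu}=1$ if $d_u\neq 0$, $\ell_{uv}=-1/\sqrt{d_ud_v}$ if $u$ and $v$ are adjacent, and $\ell_{uv}=0$ otherwise. Its eigenvalues are called the $\mathcal{L}$-eigenvalues of the graph. A $2$-$(v,k,1)$ design ($2\le k<v$) consists of $v$ points and $b$ blocks, each block being a set of $k$ points, such that any two distinct points are in exactly one common block; each point is then in $r=\frac{v-1}{k-1}$ blocks, and any two distinct blocks meet in $0$ or $1$ points. *)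

(* Defs.v *)
From HB Require Import structures.
From mathcomp Require Import all_boot all_order all_algebra.

Set Implicit Arguments.
Unset Strict Implicit.
Unset Printing Implicit Defensive.

Import Order.TTheory GRing.Theory Num.Theory.
Local Open Scope ring_scope.

Record simple_graph (V : finType) := SimpleGraph {
  adj :> rel V;
  adj_sym : symmetric adj;
  adj_irrefl : irreflexive adj }.

Definition valency (V : finType) (G : simple_graph V) (u : V) : nat :=
  #|[set w | G u w]|.

(* Rows and columns are indexed by vertices through the enumeration
   [enum_val : 'I_#|V| -> V]. *)
Definition normalized_laplacian (R : rcfType) (V : finType)
    (G : simple_graph V) : 'M[R]_#|V| :=
  \matrix_(i, j)
    let u := enum_val i in let w := enum_val j in
    if u == w then (if valency G u != 0%N then 1 else 0)
    else if G u w then - 1 / Num.sqrt ((valency G u)%:R * (valency G w)%:R)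
    else 0.

(* 2-(v,k,1) design on the point type P. The blocks form a set of subsets of P:
   as k >= 2, two equal blocks would share a pair of points, so a design with
   lambda = 1 has no repeated blocks. *)
Definition is_2design1 (P : finType) (v k : nat) (D : {set {set P}}) : Prop :=
  [/\ #|P| = v, (2 <= k < v)%N,
      forall B, B \in D -> #|B| = k
    & forall x y : P, x != y ->
        #|[set B in D | (x \in B) && (y \in B)]| = 1%N].

Definition replication (R : rcfType) (v k : nat) : R :=
  (v%:R - 1) / (k%:R - 1).

Lemma replicationP (R : rcfType) (P : finType) (v k : nat) (D : {set {set P}})
    (x : P) :
  is_2design1 v k D -> #|[set B in D | x \in B]|%:R = replication R v k.
Proof.
case=> cardP /andP[k2 ltkv] cardB pairD.
have key : (#|[set B in D | x \in B]| * (k - 1) = v - 1)%N.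
  transitivity (\sum_(B in [set B in D | x \in B]) \sum_(y in B :\ x) 1)%N.
    rewrite -sum_nat_const; apply: eq_bigr => B; rewrite inE => /andP[BD xB].
    by rewrite sum1_card -(cardB _ BD) (cardsD1 x B) xB add1n subn1.
  rewrite (exchange_big_dep (fun y => y \in [set~ x])) /=; last first.
    by move=> B y _; rewrite !inE => /andP[].
  have -> : (v - 1 = \sum_(y in [set~ x]) 1)%N.
    by rewrite sum1_card cardsC1 cardP subn1.
  apply: eq_bigr => y; rewrite !inE => yx.
  have xy : x != y by rewrite eq_sym.
  rewrite sum1_card -(pairD x y xy); apply: eq_card => B.
  by rewrite unfold_in !inE yx /= andbA.
have [k1 v1] : (1 <= k)%N /\ (1 <= v)%N.
  by split; [exact: ltnW | exact: leq_trans ltkv].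
rewrite /replication -(natrB _ k1) -(natrB _ v1).
by rewrite -key natrM mulfK // pnatr_eq0 subn_eq0 -ltnNge.
Qed.

Definition point_block (P : finType) (D : {set {set P}}) : finType :=
  (P + {B : {set P} | B \in D})%type.

Definition point_block_rel (P : finType) (D : {set {set P}}) :
    rel (point_block D) := fun u w =>
  match u, w with
  | inl _, inl _ => false
  | inl x, inr B => x \in val B
  | inr B, inl x => x \in val B
  | inr B, inr C => (B != C) && (#|val B :&: val C| == 1%N)
  end.

Lemma point_block_sym (P : finType) (D : {set {set P}}) :
  symmetric (@point_block_rel P D).
Proof. by case=> [x|B] [y|C] //=; rewrite eq_sym setIC. Qed.

Lemma point_block_irrefl (P : finType) (D : {set {set P}}) :
  irreflexive (@point_block_rel P D).
Proof. by case=> [x|B] //=; rewrite eqxx. Qed.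

Definition point_block_graph (P : finType) (D : {set {set P}}) :
    simple_graph (point_block D) :=
  SimpleGraph (@point_block_sym P D) (@point_block_irrefl P D).

(* Main.v *)
(** Conjugating by the square roots of the valencies turns the eigenvalue
    equation [x L = a x] into [\sum_(u ~ w) f u = t * d_w * f w], [t = 1 - a].
    For the point-block graph, with [f = (p, g)] on points and blocks, the
    equation at a point expresses the sum of [g] over the blocks through it by
    [p].  Substituted in the equation at a block [B], this leaves
    [(1 + t r) (\sum_(x in B) p x - k g B) = 0].  Either [t = - 1 / r], and then
    any [g] can be completed by a [p], or [g] is the blockwise average of [p];
    in the latter case the equation at a point reads
    [(r - 1) p x + \sum_y p y = t k r p x], so that [t = 1] (if [p] has nonzero
    sum) or [t = (r - 1) / (k r)]. *)
Require Import Defs.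
From HB Require Import structures.
From mathcomp Require Import all_boot all_order all_algebra.
From mathcomp Require Import ring lra.

Set Implicit Arguments.
Unset Strict Implicit.
Unset Printing Implicit Defensive.

Import Order.TTheory GRing.Theory Num.Theory.
Local Open Scope ring_scope.

(** * Eigenvectors of the normalized Laplacian, rescaled by square roots of valencies *)

Lemma valency_sum (R : pzSemiRingType) (V : finType) (G : simple_graph V) w :
  (valency G w)%:R = \sum_u (G u w)%:R :> R.
Proof.
rewrite /valency -sum1_card natr_sum big_mkcond /=.
by apply: eq_bigr => u _; rewrite inE adj_sym; case: (G u w).
Qed.

Lemma normalized_laplacianE (R : rcfType) (V : finType) (G : simple_graph V)
    i j : (forall u, valency G u != 0)%N ->
  normalized_laplacian R G i j = (i == j)%:R -
    (G (enum_val i) (enum_val j))%:R /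
      (Num.sqrt (valency G (enum_val i))%:R *
       Num.sqrt (valency G (enum_val j))%:R).
Proof.
move=> dN0; rewrite mxE /= (inj_eq enum_val_inj) dN0.
case: (eqVneq i j) => [->|_]; first by rewrite adj_irrefl mul0r subr0.
rewrite sqrtrM ?ler0n //.
by case: ifP => _; rewrite ?mul0r ?subr0 // sub0r mulNr.
Qed.

(** Nonzero valencies make the rescaling [rv] invertible, so nonzero eigenvectors correspond to
    nonzero functions [f]. *)
Lemma eigenvalue_normalized_laplacian (R : rcfType) (V : finType)
    (G : simple_graph V) (a : R) : (forall u, valency G u != 0)%N ->
  eigenvalue (normalized_laplacian R G) a <->
  exists2 f : V -> R,
    forall w, \sum_u (G u w)%:R * f u = (1 - a) * (valency G w)%:R * f w
    & exists u, f u != 0.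
Proof.
move=> dN0; pose s u : R := Num.sqrt (valency G u)%:R.
have sN0 u : s u != 0 by rewrite sqrtr_eq0 -ltNge ltr0n lt0n dN0.
have s2 u : s u * s u = (valency G u)%:R by rewrite -expr2 sqr_sqrtr ?ler0n.
pose rv (f : V -> R) : 'rV[R]_#|V| := \row_i (f (enum_val i) * s (enum_val i)).
(* The factor [s u] in [rv f] cancels the one in the denominator of the matrix entry; only the [s]
   of the column survives. *)
have rvL f i : (rv f *m normalized_laplacian R G) 0 i =
    rv f 0 i - (\sum_u (G u (enum_val i))%:R * f u) / s (enum_val i).
  rewrite mxE; set w := enum_val i.
  transitivity (\sum_j (rv f 0 j * (j == i)%:R -
                  (G (enum_val j) w)%:R * f (enum_val j) / s w)).
    apply: eq_bigr => j _; rewrite normalized_laplacianE // mulrBr.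
    by congr (_ - _); rewrite mxE -/(s _) -/w -/(s w); field; rewrite !sN0.
  rewrite sumrB; congr (_ - _).
    rewrite (bigD1 i) //= eqxx mulr1 big1 ?addr0 // => j /negPf->.
    by rewrite mulr0.
  rewrite mulr_suml (reindex (enum_val : 'I_#|V| -> V)) //=.
  exact: onW_bij (enum_val_bij _).
have rvP f : (rv f *m normalized_laplacian R G = a *: rv f) <->
    forall w, \sum_u (G u w)%:R * f u = (1 - a) * (valency G w)%:R * f w.
  split=> [E w|E].
    have := congr1 (fun M : 'rV_#|V| => M 0 (enum_rank w)) E.
    rewrite rvL !mxE enum_rankK -s2 => {}E.
    apply: (mulIf (invr_neq0 (sN0 w))).
    have -> : (1 - a) * (s w * s w) * f w / s w = f w * s w - a * (f w * s w).
      by field.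
    by rewrite -E opprB addrC subrK.
  apply/rowP => i; rewrite rvL E !mxE -s2.
  by field.
split=> [/eigenvalueP[x xL xN0]|[f fE [u fu]]].
  pose f u := x 0 (enum_rank u) / s u.
  have rvf : rv f = x.
    by apply/rowP => i; rewrite mxE /f enum_valK divfK.
  exists f; first by apply/rvP; rewrite rvf.
  have /rV0Pn[i xi] := xN0.
  by exists (enum_val i); rewrite /f enum_valK mulf_neq0 ?invr_eq0.
apply/eigenvalueP; exists (rv f); first exact/rvP.
by apply/rV0Pn; exists (enum_rank u); rewrite mxE enum_rankK mulf_neq0.
Qed.

(** * Counting identities for the incidence matrix [inc] *)

Section Design.

Variables (R : rcfType) (P : finType) (v k : nat) (D : {set {set P}}).
Hypothesis hD : is_2design1 v k D.

Let block := {B : {set P} | B \in D}.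
Let r : R := replication R v k.
Let inc (x : P) (B : block) : R := (x \in val B)%:R.

(** Passes from sums over the subtype of blocks, which are vertices, to cardinals of subsets of [D],
    in which the design axioms are stated. *)
Lemma sum_block_natr (Q : pred {set P}) :
  \sum_(B : block) (Q (val B))%:R = #|[set B in D | Q B]|%:R :> R.
Proof.
rewrite -sum1_card natr_sum (eq_bigl (fun B => (B \in D) && Q B)); last first.
  by move=> B; rewrite inE.
rewrite (reindex_omap (val : block -> _) insub) /=; last first.
  by move=> B /andP[BD _]; rewrite insubT.
rewrite [RHS]big_mkcond /=; apply: eq_bigr => B _.
by rewrite valK (valP B) eqxx andbT; case: (Q _).
Qed.

Lemma sum_inc_block x : \sum_B inc x B = r.
Proof. by rewrite /r -(replicationP R x hD) -sum_block_natr. Qed.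

Lemma sum_inc_point B : \sum_x inc x B = k%:R.
Proof.
case: hD => _ _ cardB _; rewrite -(cardB _ (valP B)) -sum1_card natr_sum.
by rewrite [RHS]big_mkcond; apply: eq_bigr => x _; rewrite /inc; case: (_ \in _).
Qed.

(** With [N] the incidence matrix [inc], this is [N N^T = (r - 1) I + J], where [J] is the all-ones
    matrix. *)
Lemma sum_inc2_block x y :
  \sum_B inc x B * inc y B = 1 + (r - 1) * (x == y)%:R.
Proof.
case: eqVneq => [<-|xy].
  rewrite mulr1 addrC subrK -(sum_inc_block x); apply: eq_bigr => B _.
  by rewrite /inc -natrM mulnb andbb.
case: hD => _ _ _ /(_ x y xy) card1.
rewrite mulr0 addr0 -[RHS]/(1%:R) -card1 -sum_block_natr.
by apply: eq_bigr => B _; rewrite /inc -natrM mulnb.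
Qed.

(** Two common points would make both blocks equal to the unique block [E] through them. *)
Lemma card_blockI (B C : block) : B != C -> (#|val B :&: val C| <= 1)%N.
Proof.
apply: contra_neqT; rewrite -ltnNge => /card_gt1P[x [y []]].
rewrite !inE => /andP[xB xC] /andP[yB yC] xy; apply: val_inj.
case: hD => _ _ _ /(_ x y xy) /eqP/cards1P[E dE].
have inE1 F : F \in D -> x \in F -> y \in F -> F = E.
  by move=> FD xF yF; apply/set1P; rewrite -dE inE FD xF yF.
by rewrite (inE1 (val B)) ?(valP B) // (inE1 (val C)) ?(valP C).
Qed.

(** This is [N^T N = k I + A], with [A] the adjacency matrix on blocks: distinct blocks share at
    most one point, so the size of their intersection is itself the adjacency indicator. *)
Lemma sum_inc2_point (B C : block) : \sum_x inc x B * inc x C =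
  k%:R * (B == C)%:R + (point_block_graph D (inr C) (inr B))%:R.
Proof.
have -> : \sum_x inc x B * inc x C = #|val B :&: val C|%:R.
  rewrite -sum1_card natr_sum [RHS]big_mkcond; apply: eq_bigr => x _.
  by rewrite /inc -natrM mulnb inE; case: (_ && _).
rewrite /= (eq_sym C) setIC; case: eqVneq => [<-|BC] /=.
  by case: hD => _ _ cardB _; rewrite setIid (cardB _ (valP B)) mulr1 addr0.
rewrite mulr0 add0r setIC.
by move: (card_blockI BC); case: #|_| => [|[|]].
Qed.

(* Blocks meeting [B], counted through their common point. *)
Lemma sum_adjacent_blocks (h : block -> R) B :
  \sum_C (point_block_graph D (inr C) (inr B))%:R * h C =
  \sum_x inc x B * (\sum_C inc x C * h C) - k%:R * h B.
Proof.
under [X in _ = X - _]eq_bigr => x _ do rewrite mulr_sumr.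
rewrite exchange_big /=.
transitivity (\sum_C ((\sum_x inc x B * inc x C) * h C
                      - k%:R * ((B == C)%:R * h C))).
  by apply: eq_bigr => C _; rewrite sum_inc2_point /=; ring.
rewrite sumrB; congr (_ - _).
  by apply: eq_bigr => C _; rewrite mulr_suml; apply: eq_bigr => x _; rewrite mulrA.
rewrite -mulr_sumr (bigD1 B) //= eqxx mul1r big1 ?addr0 // => C.
by rewrite eq_sym => /negPf->; rewrite mul0r.
Qed.

(** * Neighbour sums and valencies in the point-block graph *)

Lemma sum_neighbours_point (f : point_block D -> R) x :
  \sum_u (point_block_graph D u (inl x))%:R * f u =
  \sum_B inc x B * f (inr B).
Proof.
by rewrite big_sumType /= big1 ?add0r // => y _; rewrite mul0r.
Qed.

(** The inner sum over blocks through [x] is kept intact, so that the equation at the point [x] can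
    be substituted for it. *)
Lemma sum_neighbours_block (f : point_block D -> R) B :
  \sum_u (point_block_graph D u (inr B))%:R * f u =
  \sum_x inc x B * (f (inl x) + \sum_C inc x C * f (inr C)) - k%:R * f (inr B).
Proof.
rewrite big_sumType (sum_adjacent_blocks (fun C => f (inr C))) /= addrA.
by congr (_ - _); rewrite -big_split /=; apply: eq_bigr => x _; rewrite mulrDr.
Qed.

Lemma valency_point x : (valency (point_block_graph D) (inl x))%:R = r.
Proof.
rewrite valency_sum -(sum_inc_block x).
under eq_bigr do rewrite -[_%:R]mulr1.
rewrite (sum_neighbours_point (fun=> 1)).
by apply: eq_bigr => B _; rewrite mulr1.
Qed.

(** In the neighbour sum of the constant 1, each of the [k] points contributes [1 + r], and [k] is
    subtracted. *)
Lemma valency_block B :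
  (valency (point_block_graph D) (inr B))%:R = k%:R * r.
Proof.
rewrite valency_sum.
under eq_bigr do rewrite -[_%:R]mulr1.
rewrite (sum_neighbours_block (fun=> 1)).
under eq_bigr => x _.
  under [X in _ + X]eq_bigr do rewrite mulr1.
  rewrite sum_inc_block.
  over.
by rewrite -mulr_suml sum_inc_point; ring.
Qed.

Lemma block_size_gt1 : 1 < k%:R :> R.
Proof. by case: hD => _ /andP[k2 _] _ _; rewrite ltr1n. Qed.

Lemma replication_gt1 : 1 < r.
Proof.
case: hD => _ /andP[_ kv] _ _; have k1 := block_size_gt1.
have : k%:R < v%:R :> R by rewrite ltr_nat.
by rewrite /r /replication ltr_pdivlMr ?subr_gt0 // mul1r ltrD2r.
Qed.

Lemma card_point_eq : #|P|%:R = r * (k%:R - 1) + 1.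
Proof.
have k1 := block_size_gt1; case: hD => -> _ _ _.
by rewrite /r /replication divfK ?subrK // subr_eq0 gt_eqF.
Qed.

(** The common factor [1 + (1 - a) * r] is not cancelled, since it vanishes for [a = 1 + 1 / r]. *)
Lemma eigenvalue_point_block (a : R) :
  eigenvalue (normalized_laplacian R (point_block_graph D)) a <->
  exists (p : P -> R) (g : block -> R),
    [/\ forall x, \sum_B inc x B * g B = (1 - a) * r * p x,
        forall B, (1 + (1 - a) * r) * (\sum_x inc x B * p x)
                  = (1 + (1 - a) * r) * (k%:R * g B)
      & (exists x, p x != 0) \/ (exists B, g B != 0)].
Proof.
have r1 := replication_gt1; have k1 := block_size_gt1.
have dN0 u : (valency (point_block_graph D) u != 0)%N.
  rewrite -(pnatr_eq0 R); case: u => [x|B].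
    by rewrite valency_point gt_eqF //; lra.
  by rewrite valency_block gt_eqF // mulr_gt0 //; lra.
(* Only the point equations are assumed, so this serves both directions. *)
have blockE (f : point_block D -> R) B :
    (forall x, \sum_B inc x B * f (inr B) = (1 - a) * r * f (inl x)) ->
    \sum_u (point_block_graph D u (inr B))%:R * f u =
    (1 + (1 - a) * r) * (\sum_x inc x B * f (inl x)) - k%:R * f (inr B).
  move=> fP; rewrite sum_neighbours_block mulr_sumr; congr (_ - _).
  by apply: eq_bigr => x _; rewrite fP; ring.
rewrite eigenvalue_normalized_laplacian //; split=> [[f fE fN0]|].
  have fP x : \sum_B inc x B * f (inr B) = (1 - a) * r * f (inl x).
    by rewrite -sum_neighbours_point fE valency_point.
  exists (fun x => f (inl x)), (fun B => f (inr B)); split=> // [B|].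
    by have := fE (inr B); rewrite blockE // valency_block => E; lra.
  by case: fN0 => [[x|B] fu]; [left; exists x | right; exists B].
case=> p [g [pE gE pgN0]].
pose f (u : point_block D) := match u with inl x => p x | inr B => g B end.
exists f; last first.
  by case: pgN0 => [[x px]|[B gB]]; [exists (inl x) | exists (inr B)].
case=> [x|B]; first by rewrite sum_neighbours_point pE valency_point.
by rewrite blockE // gE valency_block /=; ring.
Qed.

(** The matrix [N N^T = (r - 1) I + J] applied to [p]. *)
Lemma sum_blockwise_average (p : P -> R) x :
  \sum_B inc x B * (\sum_y inc y B * p y) = (r - 1) * p x + \sum_y p y.
Proof.
under eq_bigr do rewrite mulr_sumr.
rewrite exchange_big /=.
transitivity (\sum_y (p y + (r - 1) * ((x == y)%:R * p y))).
  apply: eq_bigr => y _; rewrite [RHS](_ : _ = (1 + (r - 1) * (x == y)%:R) * p y).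
    by rewrite -sum_inc2_block mulr_suml; apply: eq_bigr => B _; rewrite mulrA.
  by ring.
rewrite big_split /= addrC -mulr_sumr (bigD1 x) //= eqxx mul1r.
rewrite big1 ?addr0 // => y; rewrite eq_sym => /negPf->.
by rewrite mul0r.
Qed.

End Design.

(** * The spectrum: distinctness, exhaustion and explicit eigenvectors *)

Theorem mainTheorem5 (R : rcfType) (P : finType) (v k : nat)
    (D : {set {set P}}) (hD : is_2design1 v k D) (hb : (v < #|D|)%N) :
  let r : R := replication R v k in
  let spectrum := [:: 0; 1 + 1 / r; 1 - 1 / k%:R + 1 / (r * k%:R)] in
  uniq spectrum /\
  (forall a : R,
     eigenvalue (normalized_laplacian R (point_block_graph D)) a
     <-> a \in spectrum).
Proof.
move=> r spectrum.
have r1 : 1 < r := replication_gt1 R hD.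
have k1 : 1 < k%:R :> R := block_size_gt1 R hD.
have rN0 : r != 0 by rewrite gt_eqF //; lra.
have kN0 : k%:R != 0 :> R by rewrite gt_eqF //; lra.
(* With the denominator [r * k] cleared, the values can be compared by [lra], which treats [r * k]
   as an atom; [s1_gt0] supplies the nonlinear bound [r * k > r]. *)
have e2 : (1 - 1 / k%:R + 1 / (r * k%:R)) * (r * k%:R) = r * (k%:R - 1) + 1.
  by field; rewrite kN0 rN0.
have e1 : (1 + 1 / r) * (r * k%:R) = r * k%:R + k%:R by field.
have s1_gt0 : 0 < r * (k%:R - 1) by apply: mulr_gt0; lra.
split.
  rewrite /spectrum /= !inE !negb_or !andbT; apply/andP; split.
    apply/andP; split; apply/eqP => E.
      by move: e1; rewrite -E mul0r; lra.
    by move: e2; rewrite -E mul0r; lra.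
  by apply/eqP => E; move: e2; rewrite -E e1; lra.
move=> a; rewrite (eigenvalue_point_block hD) -/r !inE; split.
  case=> p [g [pE gE pgN0]].
  have [t0|tN0] := eqVneq (1 + (1 - a) * r) 0.
    apply/orP; right; apply/orP; left; apply/eqP.
    by apply: (mulIf rN0); rewrite mulrDl divfK //; lra.
  have {}gE B := mulfI tN0 (gE B).
  have pE' x : (r - 1) * p x + \sum_y p y = k%:R * ((1 - a) * r * p x).
    rewrite -pE mulr_sumr -(sum_blockwise_average hD).
    by apply: eq_bigr => B _; rewrite gE; ring.
  (* If [p] vanished, so would its blockwise averages [g]. *)
  have [x px] : exists x, p x != 0.
    case: pgN0 => // -[B gB]; apply/existsP; apply: contraNT gB.
    move=> /existsPn p0; have /eqP := gE B; rewrite big1 => [|x _].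
      by rewrite eq_sym mulf_eq0 (negPf kN0).
    by move: (p0 x); rewrite negbK => /eqP->; rewrite mulr0.
  have [S0|SN0] := eqVneq (\sum_y p y) 0.
    apply/orP; right; apply/orP; right; apply/eqP.
    apply: (mulIf (mulf_neq0 rN0 kN0)); rewrite e2; apply: (mulIf px).
    by move: (pE' x); rewrite S0; lra.
  apply/orP; left.
  (* Summed over all points, the left side is [r - 1 + #|P| = r * k] times the total of [p], and the
     right side is [(1 - a) * r * k] times it. *)
  have : \sum_x ((r - 1) * p x + \sum_y p y) =
         \sum_x k%:R * ((1 - a) * r * p x) by apply: eq_bigr.
  rewrite big_split /= -!mulr_sumr sumr_const -[_ *+ #|_|]mulr_natr.
  rewrite (eq_card (B := P)) // (card_point_eq R hD).
  rewrite -/r => E.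
  have /eqP : a * (r * k%:R * \sum_y p y) = 0 by lra.
  by rewrite mulf_eq0 (negPf (mulf_neq0 (mulf_neq0 rN0 kN0) SN0)) orbF.
have v_gt1 : (1 < #|P|)%N.
  by rewrite -(ltr1n R) (card_point_eq R hD) -/r; lra.
have /card_gt1P[x [y [_ _ xy]]] := v_gt1.
have /set0Pn[B BD] : D != set0.
  by rewrite -card_gt0 (leq_ltn_trans _ hb).
pose B0 : {B : {set P} | B \in D} := exist _ B BD.
case/or3P => /eqP->.
(* Constant functions belong to [a = 0]. *)
- exists (fun=> 1), (fun=> 1); split=> [z|C|].
  + under eq_bigr do rewrite mulr1.
    by rewrite (sum_inc_block R hD) -/r; ring.
  + under eq_bigr do rewrite mulr1.
    by rewrite (sum_inc_point R hD) mulr1.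
  + by left; exists x; rewrite oner_neq0.
- have t0 : 1 - (1 + 1 / r) = - r^-1 by field.
  pose g (C : {B | B \in D}) : R := (C == B0)%:R.
  (* Here [(1 - a) * r = -1]: the block equations read [0 = 0], and the point equations force [p]
     from the indicator [g] of [B0]. *)
  exists (fun z => - \sum_(C : {B | B \in D}) (z \in val C)%:R * g C), g; split=> [z|C|].
  + by rewrite t0 mulNr mulVf // mulN1r opprK.
  + by rewrite t0 mulNr mulVf // subrr !mul0r.
  + by right; exists B0; rewrite /g eqxx oner_neq0.
(* A nonzero [p] of zero sum lies in the kernel of [J], so [N N^T] acts on it as [r - 1]; [g] is its
   blockwise average. *)
- pose p z : R := (z == x)%:R - (z == y)%:R.
  have p0 : \sum_z p z = 0.
    have delta1 u : \sum_z (z == u)%:R = 1 :> R.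
      by rewrite (bigD1 u) //= eqxx big1 ?addr0 // => z /negPf->.
    by rewrite sumrB !delta1 subrr.
  exists p, (fun C : {B | B \in D} => (\sum_z (z \in val C)%:R * p z) / k%:R).
  split=> [z|C|].
  + under eq_bigr do rewrite mulrA.
    rewrite -mulr_suml (sum_blockwise_average hD) p0 addr0 -/r.
    by field; rewrite kN0 rN0.
  + by congr (_ * _); rewrite mulrC divfK.
  + by left; exists x; rewrite /p eqxx (negPf xy) subr0 oner_neq0.
Qed.
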